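(* Let $n\geq 2$ and $\alpha\in(0,1)$. Let $F$ be the distribution function of a random variable $X$ taking values in $[0,1]$, with $F\in C[0,1]$, and let $Y_n$ be the empirical distribution function of a sample of size $n$ from $X$. Let $m>1$ be the first positive integer such that $$\left\|B_m(F;x)-F(x)\right\|\leq\frac{\sqrt{2\log(2/\alpha)}}{2\sqrt{n}}.$$ Then $$P\left(\left\|B_m(Y_n;x)-F(x)\right\|>\frac{\sqrt{2\log(2/\alpha)}}{\sqrt{n}}\right)\leq\alpha.$$
   Context: $\|\cdot\|$ is the supremum norm over $x\in[0,1]$; $F\in C[0,1]$ means that $F$ restricted to $[0,1]$ is continuous. Empirical distribution function: $Y_n(x)=\frac1n\sum_{r=1}^n 1_{(-\infty,x]}(X_r)$, $x\in[0,1]$, where $X_1,\dots,X_n$ are independent copies of $X$ on a probability space with probability $P$. Bernstein polynomial: for $f:[0,1]\to\mathbb{R}$, $B_m(f;x)=\sum_{j=0}^m f(j/m)\binom{m}{j}x^j(1-x)^{m-j}$; $B_m(Y_n;x)$ is the random polynomial obtained by taking $f=Y_n$. *)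

(* Defs.v *)
From HB Require Import structures.
From mathcomp Require Import all_boot all_order all_algebra.
From mathcomp Require Import all_classical all_reals all_analysis.

Set Implicit Arguments.
Unset Strict Implicit.
Unset Printing Implicit Defensive.

Import Order.TTheory GRing.Theory Num.Theory.
Import numFieldNormedType.Exports.

Local Open Scope classical_set_scope.
Local Open Scope ring_scope.

(* Extended-real valued, so that no boundedness assumption on f is hidden in a
   default value of the supremum. *)
Definition supnorm01 (R : realType) (f : R -> R) : \bar R :=
  ereal_sup [set `|f x|%:E | x in `[0, 1]].

(* Only the values of f at the points j / m of [0, 1] matter.  For m = 0, not
   used here, 0 / 0 = 0 and the value is f 0. *)
Definition bernstein (R : realType) (m : nat) (f : R -> R) (x : R) : R :=
  \sum_(j < m.+1)
    f (j%:R / m%:R) * ('C(m, j))%:R * x ^+ j * (1 - x) ^+ (m - j).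

(* s is the sample of observed values. *)
Definition empirical_cdf (R : realType) (n : nat) (s : 'I_n -> R) (x : R) : R :=
  n%:R^-1 * \sum_(r < n) \1_(`]-oo, x]) (s r).

(* Mutual independence: the product rule over every finite subfamily. *)
Definition mutually_independent d (T : measurableType d) (R : realType)
    (P : probability T R) (n : nat) (X : 'I_n -> {RV P >-> R}) : Prop :=
  forall (J : {set 'I_n}) (A : 'I_n -> set R),
    (forall i, i \in J -> measurable (A i)) ->
    P (\bigcap_(i in [set i | i \in J]) (X i @^-1` A i)) =
    (\prod_(i in J) P (X i @^-1` A i))%E.

Definition identically_distributed d d' (T : measurableType d)
    (T' : measurableType d') (R : realType) (P : probability T R)
    (P' : probability T' R) (X : {RV P >-> R}) (X' : {RV P' >-> R}) : Prop :=
  forall A : set R, measurable A -> distribution P X A = distribution P' X' A.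

(* Main.v *)
(* Bernstein operators are positive and fix constants, so B_m(Y_n) - F is at
   most the largest |Y_n - F| on the grid j/m plus |B_m F - F|.  It remains to
   prove the Dvoretzky-Kiefer-Wolfowitz inequality with Massart's constant,
   P(sup (F - Y_n) > e) <= exp (-2 n e^2), on that grid, and its mirror image.
   If r(x) counts the sample points beyond x and s = 1 - F(x), then
   (1 + b / s)^r(x) is a martingale in x starting at (1 + b)^n, for every b > 0.
   At a crossing r(x) > n (s + e) it exceeds (1 + b / s)^(n (s + e)), so the
   maximal inequality gives the bound as soon as
     (s + e) ln (1 + b / s) >= ln (1 + b) + 2 e^2   for all s > 0.
   Such a b comes from a saddle point: let q be a critical point in s of the
   divergence kl(s + e, s) of Bernoulli laws and b = e / (1 - q - e).  Then the
   left-hand side is minimal at s = q, where it exceeds ln (1 + b) by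
   kl(q + e, q), which is at least 2 e^2 by Pinsker's inequality. *)

Require Import Defs.
From HB Require Import structures.
From mathcomp Require Import all_boot all_order all_algebra.
From mathcomp Require Import all_classical all_reals all_analysis.
From mathcomp Require Import zify ring lra.

Set Implicit Arguments.
Unset Strict Implicit.
Unset Printing Implicit Defensive.

Import Order.TTheory GRing.Theory Num.Theory.
Import numFieldNormedType.Exports.

Local Open Scope classical_set_scope.
Local Open Scope ring_scope.

(** * Logarithmic inequalities and the saddle point *)

Lemma eq_ler (R : numDomainType) (x y : R) : x = y -> x <= y.
Proof. by move->. Qed.

Lemma is_derive_ge0_le (R : realType) (f df : R -> R) (a b : R) : a <= b ->
  (forall x, a <= x <= b -> is_derive x 1 f (df x)) ->
  (forall x, a <= x <= b -> 0 <= df x) -> f a <= f b.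
Proof.
move=> leab fdf df0; rewrite -subr_ge0.
have [x | | c cab ->] := MVT_segment leab (f := f) (df := df).
- by rewrite in_itv /= => /andP[/ltW ax /ltW xb]; apply: fdf; rewrite ax.
- apply: derivable_within_continuous => x; rewrite in_itv /= => xab.
  by have [] := fdf _ xab.
- by rewrite mulr_ge0 ?subr_ge0// df0// -[_ <= _ <= _]/(c \in `[a, b]).
Qed.

Lemma is_derive_lnD (R : realType) (c x : R) : 0 < x + c ->
  is_derive x 1 (fun y => ln (y + c)) (x + c)^-1.
Proof.
move=> xc.
have dD : is_derive x 1 (fun y => y + c) 1.
  by apply: is_derive_eq; rewrite addr0.
have := @is_derive1_comp R (@ln R) (fun y => y + c) x _ _ (is_derive1_ln xc) dD.
by rewrite mulr1.
Qed.

Lemma is_derive_invD (R : realType) (c x : R) : 0 < x + c ->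
  is_derive x 1 (fun y => (y + c)^-1) (- (x + c) ^- 2).
Proof.
move=> xc.
have dD : is_derive x 1 (fun y => y + c) 1.
  by apply: is_derive_eq; rewrite addr0.
apply: is_derive_eq; first by apply: (is_deriveV _ dD); rewrite gt_eqF.
by rewrite /GRing.scale /= mulr1.
Qed.

Lemma ln1D_ge (R : realType) (y : R) : 0 <= y -> 2 * y / (2 + y) <= ln (1 + y).
Proof.
move=> y0.
(* Up to the constant 2 this is ln(1 + x) - 2x / (2 + x), because 2x / (2 + x) = 2 - 4 / (x + 2). *)
pose f (x : R) := ln (x + 1) + 4 * (x + 2)^-1.
pose df (x : R) := x ^+ 2 / ((x + 1) * (x + 2) ^+ 2).
have : f 0 <= f y.
  apply: (@is_derive_ge0_le _ _ df) => // x /andP[x0 _].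
    have := @is_derive_lnD R 1 x ltac:(lra).
    have := @is_derive_invD R 2 x ltac:(lra) => dV dL.
    have dV4 := @is_deriveZ _ _ _ _ 4 _ _ _ dV.
    apply: is_derive_eq.
    rewrite /df /GRing.scale /=; field; lra.
  by rewrite /df mulr_ge0 ?sqr_ge0// invr_ge0 mulr_ge0 ?sqr_ge0//; lra.
rewrite /f !add0r ln1 add0r [1 + y]addrC => fy.
have -> : 2 * y / (2 + y) = 4 * 2^-1 - 4 * (y + 2)^-1 by field; lra.
by rewrite lerBlDr.
Qed.

Lemma is_derive_lnB (R : realType) (c x : R) : x < c ->
  is_derive x 1 (fun y => ln (c - y)) (- (c - x)^-1).
Proof.
rewrite -subr_gt0 => xc.
have dB : is_derive x 1 (fun y => c - y) (-1).
  by apply: is_derive_eq; rewrite add0r mul1r.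
have := @is_derive1_comp R (@ln R) (fun y => c - y) x _ _
  (is_derive1_ln xc) dB.
by rewrite mulrN1.
Qed.

(** With p fixed, the divergence minus the quadratic term vanishes when the second argument y
    reaches p, and it is nonincreasing up to there: its derivative carries the factor 1 - 4y(1 - y)
    = (1 - 2y)^2. *)
Lemma pinsker_bernoulli (R : realType) (p q : R) : 0 < q -> q <= p -> p < 1 ->
  2 * (p - q) ^+ 2 <=
    p * (ln p - ln q) + (1 - p) * (ln (1 - p) - ln (1 - q)).
Proof.
move=> q0 qp p1.
(* The form [y + 0] matches [is_derive_lnD] with constant 0. *)
pose f (y : R) := p * ln (y + 0) + (1 - p) * ln (1 - y) + 2 * (p - y) ^+ 2.
pose df (y : R) := (p - y) * (1 - 2 * y) ^+ 2 / (y * (1 - y)).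
have : f q <= f p.
  apply: (@is_derive_ge0_le _ _ df) => // y /andP[qy yp].
    have := @is_derive_lnD R 0 y ltac:(lra).
    have := @is_derive_lnB R 1 y ltac:(lra) => dB dD.
    have dpB : is_derive y 1 (fun y : R => p - y) (-1).
      by apply: is_derive_eq; rewrite add0r mul1r.
    have d1 := @is_deriveZ _ _ _ _ p _ _ _ dD.
    have d2 := @is_deriveZ _ _ _ _ (1 - p) _ _ _ dB.
    have d3 := @is_deriveZ _ _ _ _ 2 _ _ _ (@is_deriveX _ _ _ 1 _ _ _ dpB).
    apply: is_derive_eq.
    rewrite /df /GRing.scale /= addr0; field; lra.
  rewrite /df mulr_ge0//; last by rewrite invr_ge0 mulr_ge0//; lra.
  by rewrite mulr_ge0 ?sqr_ge0//; lra.
by rewrite /f !addr0 subrr expr0n /= mulr0; lra.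
Qed.

(** This is [ln1D_ge] at [b / s], rescaled; it makes the auxiliary function [t] of [log_ratio_min]
    nondecreasing. *)
Lemma lnB_ge (R : realType) (b s : R) : 0 <= b -> 0 < s ->
  2 * b <= (2 * s + b) * (ln (s + b) - ln s).
Proof.
move=> b0 s0; have bs0 : 0 <= b / s by rewrite divr_ge0// ltW.
have -> : ln (s + b) - ln s = ln (1 + b / s).
  rewrite -ln_div ?posrE; [|lra|lra].
  by congr ln; field; lra.
apply: (@le_trans _ _ ((2 * s + b) * (2 * (b / s) / (2 + b / s)))).
  by apply: eq_ler; field; rewrite gt_eqF//=; lra.
by rewrite ler_wpM2l ?ln1D_ge//; lra.
Qed.

(* The right-hand side has derivative (t s - t q) / (s * (s + b)), where
   t s := s * (s + b) * (ln (s + b) - ln s) - b * s is nondecreasing. *)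
Lemma log_ratio_min (R : realType) (b e q s : R) : 0 <= b -> 0 < q -> 0 < s ->
  q * (q + b) * (ln (q + b) - ln q) = b * (q + e) ->
  (q + e) * (ln (q + b) - ln q) <= (s + e) * (ln (s + b) - ln s).
Proof.
move=> b0 q0 s0 qe.
pose L (y : R) := ln (y + b) - ln (y + 0).
pose dL (y : R) := (y + b)^-1 - (y + 0)^-1.
have LE y : L y = ln (y + b) - ln y by rewrite /L addr0.
have dLP (y : R) : 0 < y -> is_derive y 1 L (dL y).
  move=> y0; have := @is_derive_lnD R b y ltac:(lra).
  have := @is_derive_lnD R 0 y ltac:(lra) => d1 d2.
  exact: is_derive_eq.
pose t (y : R) := y * (y + b) * L y - b * y.
have t_le x y : 0 < x -> x <= y -> t x <= t y.
  move=> x0 xy.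
  pose dt (y : R) := (2 * y + b) * L y - 2 * b.
  apply: (@is_derive_ge0_le _ _ dt) => // z /andP[xz zy].
    have d1 := dLP z ltac:(lra).
    apply: is_derive_eq; rewrite /dt /dL /GRing.scale /= addr0; field; lra.
  by rewrite /dt LE subr_ge0 lnB_ge//; lra.
have tq : t q = b * e by rewrite /t LE qe; ring.
pose g (y : R) := (y + e) * L y.
pose dg (y : R) := (t y - b * e) / (y * (y + b)).
have dgP (y : R) : 0 < y -> is_derive y 1 g (dg y).
  move=> y0; have d1 := dLP y y0.
  apply: is_derive_eq.
  by rewrite /dg /t /dL /GRing.scale /= addr0; field; lra.
have pos y : 0 < y -> 0 < y * (y + b) by move=> y0; rewrite mulr_gt0//; lra.
rewrite -!LE -/(g q) -/(g s).
(* As [t] is nondecreasing, [g] falls before [q] and rises after it; the first case works with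
   [- g]. *)
have [sq|/ltW qs] := leP s q.
  rewrite -lerN2.
  apply: (@is_derive_ge0_le _ (fun y => - g y) (fun y => - dg y)) => //.
    move=> x /andP[sx xq].
    have d1 := dgP x ltac:(lra).
    exact: is_derive_eq.
  move=> x /andP[sx xq].
  rewrite /dg -mulNr divr_ge0 ?(ltW (pos _ _))//; [|lra].
  by rewrite opprB subr_ge0 -tq t_le//; lra.
apply: (@is_derive_ge0_le _ g dg) => //.
  by move=> x /andP[qx xs]; apply: dgP; lra.
move=> x /andP[qx xs].
rewrite /dg divr_ge0 ?(ltW (pos _ _))//; [|lra].
by rewrite subr_ge0 -tq t_le//; lra.
Qed.

(** The difference of the two sides vanishes at 1 and has the square (1 - 1/y)^2 as derivative. *)
Lemma ln_le_subV (R : realType) (x : R) : 1 <= x -> 2 * ln x <= x - x^-1.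
Proof.
move=> x1.
pose f (y : R) := y - (y + 0)^-1 - 2 * ln (y + 0).
pose df (y : R) := (1 - y^-1) ^+ 2.
have : f 1 <= f x.
  apply: (@is_derive_ge0_le _ _ df) => // y /andP[y1 _]; last exact: sqr_ge0.
  have d1 := @is_derive_lnD R 0 y ltac:(lra).
  have d2 := @is_derive_invD R 0 y ltac:(lra).
  have d3 := @is_deriveZ _ _ _ _ 2 _ _ _ d1.
  apply: is_derive_eq.
  by rewrite /df /GRing.scale /= addr0; field; lra.
by rewrite /f !addr0 invr1 ln1; lra.
Qed.

(* The equation says that the derivative in q of the divergence between
   Bernoulli(q + e) and Bernoulli(q) vanishes. *)
Lemma exists_saddle (R : realType) (e : R) : 0 < e < 1 ->
  exists2 q : R, 0 < q < 1 - e &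
    q * (1 - q) * (ln (q + e) + ln (1 - q) - ln q - ln (1 - e - q)) = e.
Proof.
move=> /andP[e0 e1].
pose f (q : R) := (q * (1 - q)) *
  (ln (q + e) + ln (1 - q) - ln (q + 0) - ln (1 - e - q)).
(* Near 1 - e the term - ln(1 - e - q) blows up. This [d] gives ln e - ln d = 2 / (1 - e) = 1 / x0,
   which suffices for f(y0) >= e because y0 (1 - y0) >= x0 e. *)
pose d := e * expR (- (2 / (1 - e))).
pose x0 : R := (1 - e) / 2.
pose y0 : R := 1 - e - d.
have d0 : 0 < d by rewrite mulr_gt0// expR_gt0.
have dle : d <= x0.
  rewrite /d expRN -ler_pdivlMr ?invr_gt0 ?expR_gt0// invrK.
  have := expR_ge1Dx (2 / (1 - e)).
  have : 0 < x0 by rewrite /x0; lra.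
  move=> x00 h; apply: (@le_trans _ _ (x0 * (1 + 2 / (1 - e)))).
    have x0V : x0 * (2 / (1 - e)) = 1 by rewrite /x0; field; lra.
    by rewrite mulrDr mulr1 x0V; lra.
  by rewrite ler_wpM2l// ltW.
have xy : x0 <= y0 by rewrite /y0 /x0 in dle *; lra.
have f_cont : {within `[x0, y0], continuous f}.
  apply: derivable_within_continuous => q; rewrite in_itv /= => /andP[q1 q2].
  have q3 : 0 < q < 1 - e by rewrite /x0 /y0 in q1 q2; lra.
  have d1 := @is_derive_lnD R e q ltac:(lra).
  have d2 := @is_derive_lnB R 1 q ltac:(lra).
  have d3 := @is_derive_lnD R 0 q ltac:(lra).
  have d4 := @is_derive_lnB R (1 - e) q ltac:(lra).
  exact: ex_derive.
have fx0 : f x0 <= e.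
  (* At the midpoint [x0], q + e equals 1 - q and q equals 1 - e - q, so the four logarithms pair up
     and [ln_le_subV] gives exactly e. *)
  have -> : f x0 = (1 - e) * (1 + e) / 4 * (2 * ln ((1 + e) / (1 - e))).
    rewrite ln_div ?posrE; [|lra|lra].
    rewrite /f /x0 addr0.
    have -> : (1 - e) / 2 + e = (1 + e) / 2 by field.
    have -> : 1 - (1 - e) / 2 = (1 + e) / 2 by field.
    have -> : 1 - e - (1 - e) / 2 = (1 - e) / 2 by field.
    by rewrite !ln_div ?posrE; [field|lra..].
  have r1 : 1 <= (1 + e) / (1 - e) by rewrite ler_pdivlMr; lra.
  have c0 : 0 <= (1 - e) * (1 + e) / 4 by rewrite divr_ge0// mulr_ge0//; lra.
  apply: (le_trans (ler_wpM2l c0 (ln_le_subV r1))).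
  by apply: eq_ler; field; lra.
have fy0 : e <= f y0.
  have q0 : 0 < y0 by rewrite /x0 in xy; lra.
  rewrite /f addr0.
  have -> : 1 - e - y0 = d by rewrite /y0; ring.
  have -> : ln d = ln e - 2 / (1 - e).
    by rewrite /d lnM ?posrE ?expR_gt0// expRK.
  have h1 : ln y0 <= ln (y0 + e) by rewrite ler_ln ?posrE; lra.
  have yd : 1 - y0 = e + d by rewrite /y0; ring.
  have h2 : ln e <= ln (1 - y0) by rewrite yd ler_ln ?posrE; lra.
  have c0 : x0 * e <= y0 * (1 - y0).
    by apply: ler_pM; rewrite /x0 in xy *; rewrite ?/y0; lra.
  apply: (@le_trans _ _ (x0 * e * (2 / (1 - e)))).
    by apply: eq_ler; rewrite /x0; field; lra.
  have h3 : 0 < 2 / (1 - e) by rewrite divr_gt0//; lra.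
  have x0e : 0 <= x0 * e by apply: mulr_ge0; rewrite /x0; lra.
  by apply: ler_pM => //; lra.
have e_mid : Num.min (f x0) (f y0) <= e <= Num.max (f x0) (f y0).
  by rewrite ge_min le_max fx0 fy0 orbT.
have [q] := IVT xy f_cont e_mid; rewrite in_itv /= => /andP[q1 q2] fq; exists q.
  by rewrite /x0 /y0 in q1 q2 xy; lra.
by move: fq; rewrite /f addr0.
Qed.

(** * The exponential rate at a crossing *)

Lemma exists_crossing_rate (R : realType) (e : R) : 0 < e < 1 ->
  exists2 b : R, 0 < b & forall s, 0 < s ->
    ln (1 + b) + 2 * e ^+ 2 <= (s + e) * (ln (s + b) - ln s).
Proof.
move=> e01; have [q /andP[q0 qe] qE] := exists_saddle e01.
move: e01 => /andP[e0 e1].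
(* Then q + b = p(1 - q)/(1 - p) and 1 + b = (1 - q)/(1 - p), so p ln((q + b)/q) - ln(1 + b) is the
   divergence of Bernoulli(p) from Bernoulli(q). *)
pose p := q + e; pose b := e / (1 - p).
have p1 : p < 1 by rewrite /p; lra.
have b0 : 0 < b by rewrite divr_gt0//; lra.
have lnqb : ln (q + b) = ln p + ln (1 - q) - ln (1 - p).
  have -> : q + b = p * (1 - q) / (1 - p) by rewrite /b /p; field; lra.
  by rewrite ln_div ?lnM ?posrE ?mulr_gt0//; rewrite /p; lra.
have ln1b : ln (1 + b) = ln (1 - q) - ln (1 - p).
  have -> : 1 + b = (1 - q) / (1 - p) by rewrite /b /p; field; lra.
  by rewrite ln_div ?posrE//; lra.
have pE : 1 - e - q = 1 - p by rewrite /p; ring.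
exists b => // s s0.
(* The saddle equation times p / (1 - p) is the hypothesis of [log_ratio_min]. *)
have bal : q * (q + b) * (ln (q + b) - ln q) = b * (q + e).
  rewrite pE -/p in qE.
  have -> : b * (q + e) = p / (1 - p) * e by rewrite /b /p; field; lra.
  rewrite lnqb -[in RHS]qE.
  have -> : q + b = p * (1 - q) / (1 - p) by rewrite /b /p; field; lra.
  by field; lra.
apply: le_trans (log_ratio_min (ltW b0) q0 s0 bal).
rewrite -/p lnqb ln1b.
have := @pinsker_bernoulli R p q q0 ltac:(rewrite /p; lra) p1.
have -> : p - q = e by rewrite /p; ring.
by lra.
Qed.

(** Exponentiates n times the rate inequality; a larger [r] only helps since 1 + b/s > 1. A single
    [b] serves every level [s], as the process built from it requires. *)
Lemma exists_crossing_base (R : realType) (e : R) : 0 < e < 1 ->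
  exists2 b : R, 0 < b & forall (s : R) (n r : nat), 0 < s ->
    n%:R * (s + e) <= r%:R ->
    (1 + b) ^+ n * expR (2 * n%:R * e ^+ 2) <= (1 + b / s) ^+ r.
Proof.
move=> e01; have [b b0 bP] := exists_crossing_rate e01.
exists b => // s n r s0 nr.
have bs0 : 0 < b / s by rewrite divr_gt0.
have lnE : ln (s + b) - ln s = ln (1 + b / s).
  rewrite -ln_div ?posrE//; last lra.
  by congr ln; field; lra.
rewrite -[1 + b]lnK ?posrE; last lra.
rewrite -[1 + b / s]lnK ?posrE; last lra.
rewrite -!expRM_natl -expRD ler_expR.
apply: (@le_trans _ _ (n%:R * (s + e) * ln (1 + b / s))).
  apply: le_trans (_ : n%:R * (ln (1 + b) + 2 * e ^+ 2) <= _); first by lra.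
  by rewrite -mulrA ler_wpM2l// -lnE bP.
by rewrite ler_wpM2r// ln_ge0//; lra.
Qed.

(** * The one-sided inequality for a law on finitely many cells *)

(** On a fibre of the coordinatewise map [tau], [G] is constant and the sum of products factors into
    a product of sums, compared factor by factor. This plays the part of conditioning on the values
    of [tau]. *)
Lemma ler_sum_prod_fibers (R : realDomainType) (n : nat) (C : finType)
    (D : finType) (tau : C -> D) (f g : C -> R)
    (G : {pred {ffun 'I_n -> C}}) :
  (forall c, 0 <= f c) ->
  (forall d, \sum_(c | tau c == d) f c <= \sum_(c | tau c == d) g c) ->
  (forall u v : {ffun 'I_n -> C}, (forall i, tau (u i) = tau (v i)) ->
     G u = G v) ->
  \sum_(u | G u) \prod_i f (u i) <= \sum_(u | G u) \prod_i g (u i).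
Proof.
move=> f0 fg Gtau.
pose T (u : {ffun 'I_n -> C}) := [ffun i => tau (u i)].
rewrite (partition_big T xpredT)//= [leRHS](partition_big T xpredT)//=.
apply: ler_sum => d _.
have [u0 /andP[Gu0 /eqP Tu0]|none] := pickP (fun u => G u && (T u == d));
  last first.
  by rewrite !big_pred0.
have GE u : (G u && (T u == d)) = (u \in family (fun i c => tau c == d i)).
  apply/andP/familyP => [[_ /eqP <-] i|ud]; first by rewrite unfold_in ffunE.
  have Tu : T u = d by apply/ffunP => i; rewrite ffunE; apply/eqP/ud.
  rewrite Tu eqxx (Gtau u u0)// => i.
  by move/ffunP: (etrans Tu (esym Tu0)) => /(_ i); rewrite !ffunE.
rewrite (eq_bigl _ _ GE) [leRHS](eq_bigl _ _ GE).
rewrite -(bigA_distr_big_dep _ (fun _ => f)).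
rewrite -(bigA_distr_big_dep _ (fun _ => g)).
by apply: ler_prod => i _; rewrite sumr_ge0//=.
Qed.

Section finite_dkw.
Variables (R : realType) (K n : nat) (q : 'I_K -> R).
Hypothesis q_ge0 : forall c, 0 <= q c.
Hypothesis q_sum1 : \sum_c q c = 1.

Let weight (u : {ffun 'I_n -> 'I_K}) := \prod_i q (u i).
Let tail (k : nat) := \sum_(c : 'I_K | (k <= c)%N) q c.
Let above (k : nat) (u : {ffun 'I_n -> 'I_K}) := #|[pred i | (k <= u i)%N]|.

Let weight_ge0 u : 0 <= weight u. Proof. exact: prodr_ge0. Qed.

Let weight_sum : \sum_u weight u = 1.
Proof.
rewrite /weight -(bigA_distr_bigA (fun _ : 'I_n => q)) /=.
by rewrite big1.
Qed.

Let tail_ge0 k : 0 <= tail k. Proof. exact: sumr_ge0. Qed.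

Let tail_le k l : (k <= l)%N -> tail l <= tail k.
Proof.
move=> kl; rewrite /tail [leRHS](bigID (fun c : 'I_K => (l <= c)%N)) /=.
rewrite [X in _ <= X + _](eq_bigl (fun c : 'I_K => (l <= c)%N)).
  by rewrite lerDl sumr_ge0.
by move=> c; lia.
Qed.

(* When [tail k] is 0, Rocq's division makes the factor 1, which keeps the
   process below a supermartingale. *)
Let factor (b : R) (k : nat) (c : 'I_K) :=
  if (k <= c)%N then 1 + b / tail k else 1.

(** The supermartingale step for one coordinate. [minn c k] is what is known at level [k]: the cell
    itself if below [k], otherwise only that it is at least [k]. Only the latter fibre sees a change
    of factor. *)
Let factor_sum (b : R) k (d : 'I_k.+1) : 0 <= b ->
  \sum_(c : 'I_K | minn c k == d) q c * factor b k.+1 c <=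
  \sum_(c : 'I_K | minn c k == d) q c * factor b k c.
Proof.
move=> b0; have := leq_ord d; rewrite leq_eqVlt => /orP[/eqP dk|dk]; last first.
  apply: eq_ler.
  apply: eq_bigr => c /eqP cd; rewrite /factor.
  by rewrite !ifN// -ltnNge; lia.
have E (c : 'I_K) : (minn c k == d) = (k <= c)%N by rewrite dk; lia.
rewrite (eq_bigl _ _ E) [leRHS](eq_bigl _ _ E).
(* x * (b / x) is b for x nonzero and 0 for x = 0, hence monotone in x >= 0. *)
have tail_div x y : 0 <= x -> x <= y -> x * (b / x) <= y * (b / y).
  move=> x0 xy; have [->|xn0] := eqVneq x 0.
    by rewrite mul0r mulr_ge0 ?divr_ge0// (le_trans x0).
  have yn0 : y != 0.
    by rewrite gt_eqF// (lt_le_trans _ xy)// lt_neqAle eq_sym xn0.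
  by rewrite [x * _]mulrC [y * _]mulrC !divfK.
have -> : \sum_(c < K | (k <= c)%N) q c * factor b k c
    = tail k + tail k * (b / tail k).
  rewrite -[X in _ = X + _]mulr1 -mulrDr mulr_suml.
  by apply: eq_bigr => c kc; rewrite /factor kc.
have -> : \sum_(c < K | (k <= c)%N) q c * factor b k.+1 c
    = tail k + tail k.+1 * (b / tail k.+1).
  rewrite (eq_bigr (fun c : 'I_K =>
      q c + if (k < c)%N then q c * (b / tail k.+1) else 0)); last first.
    by move=> c _; rewrite /factor; case: ifP; rewrite ?mulrDr ?mulr1 ?addr0.
  rewrite big_split /= -big_mkcondr /= [in RHS]mulr_suml; congr (_ + _).
  by apply: eq_bigl => c; lia.
by rewrite lerD2l tail_div// tail_le.
Qed.

Let prod_factor (b : R) k (u : {ffun 'I_n -> 'I_K}) :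
  \prod_i factor b k (u i) = (1 + b / tail k) ^+ above k u.
Proof.
by rewrite /factor -big_mkcond /= prodr_const.
Qed.

Let cross (e : R) k u : bool := n%:R * (tail k + e) < (above k u)%:R.

Let crossed e k u := has (fun j => cross e j u) (iota 0 k).

(** Having crossed at no level up to [k] depends only on the cells capped at [k], so the
    one-coordinate comparison passes to products on this event. *)
Let supermartingale (e b : R) k : 0 < b ->
  \sum_(u | ~~ crossed e k.+1 u) weight u * \prod_i factor b k.+1 (u i) <=
  \sum_(u | ~~ crossed e k.+1 u) weight u * \prod_i factor b k (u i).
Proof.
move=> b0; rewrite /weight.
under eq_bigr do rewrite -big_split /=.
under [leRHS]eq_bigr do rewrite -big_split /=.
apply: (@ler_sum_prod_fibers _ n 'I_K 'I_k.+1
  (fun c => @Ordinal k.+1 (minn c k) (geq_minr c k))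
  (fun c => q c * factor b k.+1 c) (fun c => q c * factor b k c)).
- move=> c; rewrite mulr_ge0// /factor; case: ifP => // _.
  by rewrite addr_ge0// divr_ge0// ltW.
- by move=> d; apply: factor_sum; rewrite ltW.
- move=> u v uv; congr (~~ _); apply: eq_in_has => j.
  rewrite mem_iota add0n ltnS => /= jk; rewrite /cross; congr (_ < _%:R).
  apply: eq_card => i; rewrite !inE.
  by have /(congr1 val) /= := uv i; lia.
Qed.

(** Stopping at the first crossing: crossed samples are frozen at the threshold, the others keep
    their current product, and the total never increases with [k]. *)
Let maximal_inequality (e b : R) : 0 < e -> 0 < b -> (0 < n)%N ->
    (forall (s : R) (r : nat), 0 < s -> n%:R * (s + e) <= r%:R ->
      (1 + b) ^+ n * expR (2 * n%:R * e ^+ 2) <= (1 + b / s) ^+ r) ->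
  forall k,
    \sum_(u | crossed e k u)
      weight u * ((1 + b) ^+ n * expR (2 * n%:R * e ^+ 2))
    + \sum_(u | ~~ crossed e k u) weight u * \prod_i factor b k (u i)
  <= (1 + b) ^+ n.
Proof.
move=> e0 b0 n0 bP; set C := _ * expR _.
elim=> [|k IHk].
  rewrite big_pred0// add0r.
  have tail0 : tail 0 = 1 by [].
  rewrite (eq_bigr (fun u => weight u * (1 + b) ^+ n)); last first.
    by move=> u _; rewrite /factor /= tail0 divr1 prodr_const card_ord.
  by rewrite -mulr_suml weight_sum mul1r.
apply: le_trans IHk.
apply: le_trans (lerD (lexx _) (supermartingale _ _ b0)) _.
have cS u : crossed e k.+1 u = crossed e k u || cross e k u.
  by rewrite /crossed -addn1 iotaD has_cat /= add0n orbF.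
rewrite (bigID (crossed e k)) /=.
rewrite [X in _ <= _ + X](bigID (cross e k)) /= -!addrA.
apply: lerD.
  by apply: eq_ler; apply: eq_bigl => u;
    rewrite cS; case: (crossed e k u); rewrite ?andbF.
apply: lerD; last first.
  by apply: eq_ler; apply: eq_bigl => u; rewrite cS negb_or.
rewrite [leLHS](eq_bigl (fun u => ~~ crossed e k u && cross e k u)); last first.
  by move=> u; rewrite cS; case: (crossed e k u); rewrite ?andbF ?andbT.
apply: ler_sum => u /andP[_ ku]; rewrite prod_factor.
(* If [tail k] is 0, [bP] does not apply, but a crossing then puts a sample point in a cell of
   probability 0. *)
have := tail_ge0 k; rewrite le_eqVlt => /orP[/eqP tk0|tk0].
  suff -> : weight u = 0 by rewrite !mul0r.
  have : (0 < above k u)%N.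
    by rewrite -(ltr_nat R) (lt_trans _ ku)// -tk0 add0r mulr_gt0// ltr0n.
  move=> /card_gt0P[i]; rewrite inE => ki.
  have qi0 : q (u i) = 0.
    apply/eqP; rewrite eq_le q_ge0 andbT tk0 /tail (bigD1 (u i))//=.
    by rewrite lerDl sumr_ge0.
  by rewrite /weight (bigD1 i)//= qi0 mul0r.
by rewrite ler_wpM2l// bP// ltW.
Qed.

(** The maximal inequality after all [K] levels, with the uncrossed part dropped and (1 + b)^n
    cancelled. *)
Lemma one_sided_dkw (e : R) : (0 < n)%N -> 0 < e ->
  \sum_(u : {ffun 'I_n -> 'I_K} | [exists k : 'I_K,
      n%:R * (\sum_(c : 'I_K | (k <= c)%N) q c + e)
        < #|[pred i | (k <= u i)%N]|%:R]) \prod_i q (u i)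
    <= expR (- (2 * n%:R * e ^+ 2)).
Proof.
move=> n0 e0.
(* For e >= 1 no crossing is possible, since a count is at most n. *)
have [e1|e1] := ltP e 1; last first.
  rewrite big_pred0 ?expR_ge0// => u; apply/existsP => -[k].
  rewrite ltNge => /negP; apply.
  apply: (@le_trans _ _ (n%:R : R)).
    by rewrite ler_nat (leq_trans (max_card _))// card_ord.
  by rewrite ler_peMr// ler_wpDl// sumr_ge0.
have [b b0 bP] := @exists_crossing_base R e ltac:(by rewrite e0).
have := maximal_inequality e0 b0 n0 (fun s r => bP s n r) K.
rewrite -mulr_suml => max_ineq.
have c0 : 0 < (1 + b) ^+ n by rewrite exprn_gt0// addr_gt0.
rewrite expRN -div1r ler_pdivlMr ?expR_gt0//.
rewrite -(ler_pM2r c0) mul1r -[leLHS]mulrA [X in _ * X <= _]mulrC.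
apply: le_trans max_ineq; apply: ler_wpDr.
  rewrite sumr_ge0// => u _; rewrite mulr_ge0// prodr_ge0// => i _.
  by rewrite /factor; case: ifP => // _; rewrite addr_ge0// divr_ge0// ltW.
apply: eq_ler; congr (_ * _); apply: eq_bigl => u.
apply/existsP/hasP => [[k ku]|[k]].
  by exists (val k) => //; rewrite mem_iota /=.
by rewrite mem_iota add0n => /andP[_ kK] ku; exists (Ordinal kK).
Qed.
End finite_dkw.

(** Reversing the order of the cells turns lower tails into upper ones; the two bounds together
    control both signs of the deviation. *)
Lemma one_sided_dkw_rev (R : realType) (K n : nat) (q : 'I_K -> R) :
  (forall c, 0 <= q c) -> \sum_c q c = 1 ->
  forall e : R, (0 < n)%N -> 0 < e ->
  \sum_(u : {ffun 'I_n -> 'I_K} | [exists k : 'I_K,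
      n%:R * (\sum_(c : 'I_K | (c <= k)%N) q c + e)
        < #|[pred i | (u i <= k)%N]|%:R]) \prod_i q (u i)
    <= expR (- (2 * n%:R * e ^+ 2)).
Proof.
move=> q0 q1 e n0 e0.
pose q' c := q (rev_ord c).
have q'1 : \sum_c q' c = 1.
  rewrite -q1 (reindex_inj rev_ord_inj)/=.
  by apply: eq_bigr => c _; rewrite /q' rev_ordK.
have := @one_sided_dkw R K n q' (fun c => q0 _) q'1 e n0 e0.
apply: le_trans.
pose rev_cells (u : {ffun 'I_n -> 'I_K}) := [ffun i => rev_ord (u i)].
rewrite (reindex rev_cells) /rev_cells /=; last first.
  by exists rev_cells => u _; apply/ffunP => i; rewrite !ffunE rev_ordK.
apply: eq_ler; apply: eq_big => [u|u _]; last first.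
  by apply: eq_bigr => i _; rewrite /q' ffunE.
have crossE (k : 'I_K) :
    (n%:R * (\sum_(c : 'I_K | (c <= rev_ord k)%N) q c + e)
      < #|[pred i | ([ffun i => rev_ord (u i)] i <= rev_ord k)%N]|%:R) =
    (n%:R * (\sum_(c : 'I_K | (k <= c)%N) q' c + e)
      < #|[pred i | (k <= u i)%N]|%:R).
  congr (_ * (_ + _) < _%:R).
    rewrite (reindex_inj rev_ord_inj) /=; apply: eq_bigl => c.
    by have := ltn_ord c; have := ltn_ord k; lia.
  apply: eq_card => i; rewrite !inE ffunE /=.
  by have := ltn_ord (u i); have := ltn_ord k; lia.
apply/existsP/existsP => -[k].
  by rewrite -[k]rev_ordK crossE => ku; exists (rev_ord k).
by rewrite -crossE => ku; exists (rev_ord k).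
Qed.

(** * Events determined by finitely many cells *)

Lemma measure_preimage_finType d (T : measurableType d) (R : realType)
    (mu : {measure set T -> \bar R}) (C : finType) (f : T -> C) (B : {pred C}) :
  (forall c, measurable (f @^-1` [set c])) ->
  mu [set w | B (f w)] = (\sum_(c | B c) mu (f @^-1` [set c]))%E.
Proof.
move=> mf.
have -> : [set w | B (f w)] = \bigcup_(c in [set` enum B]) (f @^-1` [set c]).
  apply/seteqP; split => [w /= Bw|w [c /=]].
    by exists (f w) => //=; rewrite mem_enum.
  by rewrite mem_enum => Bc ->.
rewrite measure_fin_bigcup //.
- by rewrite -fsbig_seq ?enum_uniq// big_enum.
- by move=> c c' _ _ [w [/= -> ->]].
Qed.

(** The preimage of a vector of cells is an intersection over all indices, where independence for
    the full index set yields the product law. *)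
Lemma indep_cells d (T : measurableType d) (R : realType) (P : probability T R)
    (n : nat) (X : 'I_n -> {RV P >-> R}) (C : finType) (cell : R -> C)
    (q : C -> R) (B : {pred {ffun 'I_n -> C}}) :
  mutually_independent X ->
  (forall c, measurable (cell @^-1` [set c])) ->
  (forall i c, P (X i @^-1` (cell @^-1` [set c])) = (q c)%:E) ->
  P [set w | B [ffun i => cell (X i w)]] = (\sum_(u | B u) \prod_i q (u i))%:E.
Proof.
move=> Xind mcell Pq.
pose f w := [ffun i => cell (X i w)].
have fE u : f @^-1` [set u] = \bigcap_(i in [set i | i \in [set: 'I_n]%SET])
    (X i @^-1` (cell @^-1` [set u i])).
  apply/seteqP; split => [w /= fw i _|w fw]; first by rewrite /= -fw ffunE.
  by apply/ffunP => i; rewrite ffunE; apply: fw; rewrite /= inE.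
rewrite (@measure_preimage_finType _ _ _ P _ f B).
  rewrite -sumEFin; apply: eq_bigr => u _.
  rewrite fE.
  have /= -> := Xind [set: 'I_n]%SET _ (fun i _ => mcell (u i)).
  rewrite -prodEFin; apply: eq_big => [i|i _]; first by rewrite inE.
  exact: Pq.
move=> u; rewrite fE; apply: fin_bigcap_measurable; first exact: finite_finset.
move=> i _; rewrite -[X in measurable X]setTI.
exact: measurable_funPT.
Qed.

(** * Bernstein polynomials and the grid *)

Lemma bernstein_dist (R : realType) (m : nat) (f g : R -> R) (e x : R) :
  0 <= x <= 1 ->
  (forall j, (j <= m)%N -> `|f (j%:R / m%:R) - g (j%:R / m%:R)| <= e) ->
  `|bernstein m f x - bernstein m g x| <= e.
Proof.
move=> /andP[x0 x1] fg.
have x1' : 0 <= 1 - x by rewrite subr_ge0.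
pose w (j : 'I_m.+1) := ('C(m, j))%:R * x ^+ j * (1 - x) ^+ (m - j).
have w0 j : 0 <= w j by rewrite !mulr_ge0 ?exprn_ge0.
(* By the binomial expansion of ((1 - x) + x)^m; the difference is thus an average of the
   differences at the nodes. *)
have w1 : \sum_j w j = 1.
  rewrite -[RHS](expr1n _ m) -[X in _ = X ^+ _](subrK x) exprDn.
  apply: eq_bigr => j _; rewrite /w -[in RHS]mulr_natr; ring.
rewrite /bernstein -sumrB [leRHS](_ : e = \sum_j e * w j); last first.
  by rewrite -mulr_sumr w1 mulr1.
apply: (le_trans (ler_norm_sum _ _ _)); apply: ler_sum => j _.
set a := f _; set b := g _.
have -> : a * 'C(m, j)%:R * x ^+ j * (1 - x) ^+ (m - j) -
    b * 'C(m, j)%:R * x ^+ j * (1 - x) ^+ (m - j) = (a - b) * w j.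
  by rewrite /w; ring.
rewrite normrM (ger0_norm (w0 j)).
by rewrite ler_wpM2r// fg// -ltnS.
Qed.

Section grid.
Variables (R : realType) (m : nat).
Hypothesis m_gt0 : (0 < m)%N.

Let below (x : R) : pred nat := fun j => x <= j%:R / m%:R.

Lemma grid_cell_subproof x : (find (below x) (iota 0 m.+1) < m.+2)%N.
Proof. by rewrite ltnS (leq_trans (find_size _ _))// size_iota. Qed.

(** The index of the first grid point not below [x], or m + 1 if [x] exceeds 1. Cells are closed on
    the right, so that initial unions of cells are the half-lines measured by a distribution
    function. *)
Definition grid_cell x : 'I_m.+2 := Ordinal (grid_cell_subproof x).
Arguments grid_cell : simpl never.

Lemma grid_cell_le x k : (k <= m)%N ->
  (grid_cell x <= k)%N = (x <= k%:R / m%:R).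
Proof.
move=> km.
have -> : nat_of_ord (grid_cell x) = find (below x) (iota 0 m.+1) by [].
apply/idP/idP => [fk|xk].
  have has_b : has (below x) (iota 0 m.+1).
    by rewrite has_find size_iota ltnS (leq_trans fk).
  have := nth_find 0%N has_b; rewrite nth_iota ?add0n /below => [xf|].
    apply: (le_trans xf); rewrite ler_pM2r ?invr_gt0 ?ltr0n//.
    by rewrite ler_nat.
  by rewrite ltnS (leq_trans fk).
rewrite leqNgt; apply/negP => kf; have := before_find 0%N kf.
by rewrite nth_iota ?ltnS// add0n /below xk.
Qed.

Lemma measurable_grid_cell c : measurable (grid_cell @^-1` [set c]).
Proof.
have mle k : measurable [set x | (grid_cell x <= k)%N].
  have [km|mk] := leqP k m.
    have -> : [set x | (grid_cell x <= k)%N] = `]-oo, (k%:R / m%:R)]%classic.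
      by apply/seteqP; split => x /=; rewrite in_itv /= -grid_cell_le.
    exact: measurable_itv.
  have -> : [set x | (grid_cell x <= k)%N] = setT; last exact: measurableT.
  by apply/seteqP; split => // x _; exact: leq_trans (leq_ord (grid_cell x)) mk.
have -> : grid_cell @^-1` [set c] = [set x | (grid_cell x <= c)%N] `\`
    \bigcup_(k in [set k | (k < c)%N]) [set x | (grid_cell x <= k)%N].
  apply/seteqP; split => [x xc|x [xc nk]].
    rewrite -xc; split => [|[k kc]]; first exact: leqnn.
    by rewrite /mkset leqNgt => /negP; exact.
  apply/val_inj/eqP; rewrite eqn_leq xc leqNgt; apply/negP => xk; apply: nk.
  by exists (grid_cell x); [exact: xk|exact: leqnn].
by apply: measurableD => //; apply: bigcup_measurable.
Qed.

End grid.
Arguments grid_cell : simpl never.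

(** Hence the Bernstein polynomial of Y_n depends on the sample only through its cells. *)
Lemma empirical_cdf_grid (R : realType) (m n : nat) (s : 'I_n -> R) (j : nat) :
  (0 < m)%N -> (j <= m)%N ->
  empirical_cdf s (j%:R / m%:R) =
    n%:R^-1 * #|[pred i | (grid_cell m (s i) <= j)%N]|%:R.
Proof.
move=> m0 jm; rewrite /empirical_cdf -sum1_card natr_sum [in RHS]big_mkcond /=.
congr (_ * _); apply: eq_bigr => i _.
rewrite indicE mem_setE in_itv [X in _ = if X then _ else _]inE grid_cell_le//=.
by case: (_ <= _).
Qed.

(** * From the two one-sided bounds to the supremum norm *)

Theorem corollary4p2 (R : realType)
    (d0 : measure_display) (T0 : measurableType d0) (P0 : probability T0 R)
    (X : {RV P0 >-> R})
    (d : measure_display) (T : measurableType d) (P : probability T R)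
    (n : nat) (Xs : 'I_n -> {RV P >-> R})
    (alpha : R) (F : R -> R) (m : nat)
    (n_ge2 : (2 <= n)%N)
    (alpha01 : 0 < alpha < 1)
    (X01 : forall w : T0, 0 <= X w <= 1)
    (F_cdf : forall x : R, (F x)%:E = cdf X x)
    (F_cont : {within `[0, 1], continuous F})
    (Xs_indep : mutually_independent Xs)
    (Xs_copies : forall r : 'I_n, identically_distributed (Xs r) X)
    (m_gt1 : (1 < m)%N)
    (m_bound : (supnorm01 (fun x => (bernstein m F x - F x)%R)
      <= (Num.sqrt (2 * ln (2 / alpha)) / (2 * Num.sqrt n%:R))%R%:E)%E)
    (m_first : forall k : nat, (1 < k < m)%N ->
      ~ (supnorm01 (fun x => (bernstein k F x - F x)%R)
         <= (Num.sqrt (2 * ln (2 / alpha)) / (2 * Num.sqrt n%:R))%R%:E)%E) :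
  (P [set w | (supnorm01
         (fun x => (bernstein m (empirical_cdf (fun r => Xs r w)) x - F x)%R)
       > (Num.sqrt (2 * ln (2 / alpha)) / Num.sqrt n%:R)%R%:E)%E]
   <= alpha%:E)%E.
Proof.
move: alpha01 => /andP[a0 a1].
have m0 : (0 < m)%N by apply: ltnW.
have n0 : (0 < n)%N by apply: ltnW.
have n0R : 0 < n%:R :> R by rewrite ltr0n.
have sn0 : 0 < Num.sqrt n%:R :> R by rewrite sqrtr_gt0.
have l0 : 0 < ln (2 / alpha) by rewrite ln_gt0// ltr_pdivlMr// mul1r; lra.
set e := Num.sqrt (2 * ln (2 / alpha)) / (2 * Num.sqrt n%:R) in m_bound *.
have e0 : 0 < e by rewrite divr_gt0 ?sqrtr_gt0 ?mulr_gt0.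
(* One [e] is spent on B_m F - F, the other on the grid deviation. *)
have -> : Num.sqrt (2 * ln (2 / alpha)) / Num.sqrt n%:R = e + e.
  by rewrite /e; field; lra.
(* Each one-sided bound costs alpha / 2. *)
have tail_alpha : expR (- (2 * n%:R * e ^+ 2)) = alpha / 2.
  have -> : 2 * n%:R * e ^+ 2 = ln (2 / alpha).
    rewrite /e expr_div_n exprMn !sqr_sqrtr ?mulr_ge0 ?ltW//.
    by field; lra.
  by rewrite expRN lnK ?posrE ?divr_gt0// invf_div.
pose cell := @grid_cell R m.
pose cells w := [ffun i => cell (Xs i w)].
have mcell c : measurable (cell @^-1` [set c]) by exact: measurable_grid_cell.
pose q c := fine (P0 (X @^-1` (cell @^-1` [set c]))).
have mXcell c : measurable (X @^-1` (cell @^-1` [set c])).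
  by rewrite -[X in measurable X]setTI; exact: measurable_funPT.
have qE c : P0 (X @^-1` (cell @^-1` [set c])) = (q c)%:E.
  by rewrite fineK// fin_num_measure.
have Pq i c : P (Xs i @^-1` (cell @^-1` [set c])) = (q c)%:E.
  by rewrite -qE; exact: (Xs_copies i).
have q0 c : 0 <= q c by rewrite fine_ge0.
have qB (B : {pred 'I_m.+2}) :
    P0 [set w | B (cell (X w))] = (\sum_(c | B c) q c)%:E.
  rewrite (@measure_preimage_finType _ _ _ P0 _ (cell \o X) B)//.
  by rewrite -sumEFin; apply: eq_bigr => c _; rewrite -qE.
have q1 : \sum_c q c = 1.
  apply: EFin_inj; rewrite -(qB xpredT) -(probability_setT P0).
  by congr (P0 _); apply/seteqP; split.
have qF j : (j <= m)%N -> \sum_(c : 'I_m.+2 | (c <= j)%N) q c = F (j%:R / m%:R).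
  move=> jm; apply: EFin_inj; rewrite F_cdf -(qB (fun c => (c <= j)%N)).
  rewrite /cdf /distribution /pushforward; congr (P0 _).
  apply/seteqP; split => w; rewrite /preimage /mkset grid_cell_le//;
    by rewrite in_itv.
have bernstein_cells w w' : cells w = cells w' ->
    bernstein m (empirical_cdf (fun r => Xs r w)) =
    bernstein m (empirical_cdf (fun r => Xs r w')).
  move=> ww'; apply/funext => x; apply: eq_bigr => j _; congr (_ * _ * _ * _).
  rewrite !empirical_cdf_grid ?(leq_ord j)//; congr (_ * _%:R).
  apply: eq_card => i; rewrite !inE.
  move/ffunP: ww' => /(_ i); rewrite !ffunE /cell => wi.
  by rewrite wi.
set E := (X in P X).
(* By [bernstein_cells], [E] is a union of fibres of [cells], so it is recovered from its image
   [bad], to which the product law applies. *)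
pose bad u := `[< exists2 w, E w & cells w = u >].
have -> : E = [set w | bad (cells w)].
  apply/seteqP; split => [w Ew|w /asboolP[w' Ew' ww']].
    by apply/asboolP; exists w.
  by rewrite /E /= -(bernstein_cells _ _ ww').
rewrite (indep_cells bad Xs_indep mcell Pq) lee_fin.
(* [up] expresses an excess of Y_n over F by more than [e], [low] one of F over Y_n. *)
set up := fun u : {ffun 'I_n -> 'I_m.+2} => [exists k : 'I_m.+2,
  n%:R * (\sum_(c : 'I_m.+2 | (c <= k)%N) q c + e)
    < #|[pred i | (u i <= k)%N]|%:R].
set low := fun u : {ffun 'I_n -> 'I_m.+2} => [exists k : 'I_m.+2,
  n%:R * (\sum_(c : 'I_m.+2 | (k <= c)%N) q c + e)
    < #|[pred i | (k <= u i)%N]|%:R].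
have bad_cross u : bad u -> up u || low u.
  move=> /asboolP[w Ew <-{u}]; apply: contraPT Ew.
  rewrite negb_or => /andP[/existsPn nup /existsPn nlow].
  apply/negP; rewrite -leNgt; apply: ge_ereal_sup => _ [x /= + <-].
  rewrite in_itv /= => x01; rewrite lee_fin.
  rewrite -[X in X - F x](subrK (bernstein m F x)) -addrA.
  apply: (le_trans (ler_normD _ _)); apply: lerD; last first.
    rewrite -lee_fin; apply: le_trans m_bound; apply: ereal_sup_ubound.
    by exists x => //=; rewrite in_itv.
  apply: bernstein_dist => // j jm; rewrite empirical_cdf_grid//.
  have jK : (j < m.+2)%N by rewrite ltnS leqW.
  (* The complement of the cells up to [j] starts at [j.+1], so [low] is read one level higher than
     [up]. *)
  have jK' : (j.+1 < m.+2)%N by rewrite !ltnS.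
  have := nup (Ordinal jK); have := nlow (Ordinal jK').
  rewrite -!leNgt /= qF//.
  have -> : \sum_(c : 'I_m.+2 | (j < c)%N) q c = 1 - F (j%:R / m%:R).
    apply: (addrI (F (j%:R / m%:R))); rewrite [RHS]addrC subrK -[RHS]q1.
    rewrite [RHS](bigID (fun c : 'I_m.+2 => (c <= j)%N)) /= qF//; congr (_ + _).
    by apply: eq_bigl => c; rewrite ltnNge.
  set A := [pred i | (grid_cell m (Xs i w) <= j)%N].
  have -> : #|[pred i | (cells w i <= j)%N]| = #|A|.
    by apply: eq_card => i; rewrite !inE ffunE.
  have -> : #|[pred i | (j < cells w i)%N]|%:R = n%:R - #|A|%:R :> R.
    rewrite -[in n%:R](card_ord n) -(cardC A) natrD addrAC subrr add0r.
    by congr _%:R; apply: eq_card => i; rewrite !inE ffunE ltnNge.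
  (* [y] is Y_n(j/m); dividing both counts by n leaves y <= F + e and 1 - y <= 1 - F + e. *)
  set y := n%:R^-1 * _; have -> : #|A|%:R = n%:R * y by rewrite mulVKf ?gt_eqF.
  rewrite -[X in X - _ <= _]mulr1 -mulrBr !ler_pM2l// => ylow yup.
  by rewrite ler_norml; lra.
(* Union bound over the two signs. *)
apply: (@le_trans _ _ (\sum_(u | up u) \prod_i q (u i) +
                       \sum_(u | low u) \prod_i q (u i))).
  rewrite [leLHS]big_mkcond [X in _ <= X + _]big_mkcond.
  rewrite [X in _ <= _ + X]big_mkcond.
  rewrite -big_split /=; apply: ler_sum => u _.
  have w0 : 0 <= \prod_i q (u i) by apply: prodr_ge0.
  have := bad_cross u; case: (bad u) => [/(_ isT)|_].
    by case: (up u); case: (low u); rewrite ?addr0 ?add0r// lerDl.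
  by apply: addr_ge0; case: ifP.
rewrite (splitr alpha) -tail_alpha; apply: lerD.
  exact: one_sided_dkw_rev.
exact: one_sided_dkw.
Qed.
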